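(* For every nondefective (i.e. diagonalizable) matrix $A\in\mathbb{C}^{n\times n}$, $$G(A)=\mathrm{Co}(\sigma(A)),$$ where $\mathrm{Co}(\sigma(A))$ denotes the convex hull (in $\mathbb{C}$) of the spectrum $\sigma(A)$ of $A$, and $G(A)$ is the generalized two-sided field of values of $A$.
   Context: $X^{*}$ denotes the conjugate transpose. For a nondefective matrix $A\in\mathbb{C}^{n\times n}$ with diagonalization $A=V\Lambda V^{-1}$ ($V$ nonsingular with columns right eigenvectors of $A$, $\Lambda$ the diagonal matrix of eigenvalues), the generalized two-sided field of values is $$G(A)=\{y^{*}Ax : x,y\in\mathbb{C}^{n},\ y=(VV^{*})^{-1}x,\ y^{*}x=1\}.$$ The notation does not display $V$; the statement is understood for an arbitrary choice of diagonalization. *)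

(* Defs.v *)
From mathcomp Require Import all_boot all_order all_algebra.
From mathcomp Require Import spectral complex.
From mathcomp Require Import classical_sets reals convex.

Set Implicit Arguments.
Unset Strict Implicit.
Unset Printing Implicit Defensive.

Import Order.TTheory GRing.Theory Num.Theory.

Local Open Scope classical_set_scope.
Local Open Scope ring_scope.
Local Open Scope complex_scope.
Local Open Scope sesquilinear_scope.

(* [A] is nondefective exactly when such [V] and [L] exist; the equation forces
   the columns of [V] to be right eigenvectors of [A] and the diagonal entries
   of [L] to be the corresponding eigenvalues. *)
Definition is_diagonalization (R : realType) (n : nat)
    (A V L : 'M[R[i]]_n) : Prop :=
  [/\ V \in unitmx, is_diag_mx L & A = V *m L *m invmx V].

(* [V] is meant to diagonalize [A]. *)
Definition two_sided_field_of_values (R : realType) (n : nat)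
    (V A : 'M[R[i]]_n) : set R[i] :=
  [set z | exists x y : 'cV[R[i]]_n,
    [/\ y = invmx (V *m V ^t*) *m x,
        (y ^t* *m x) 0 0 = 1 &
        z = (y ^t* *m A *m x) 0 0]].

(* [eigenvalue] is defined through row (left) eigenvectors; a square matrix
   over a field has the same eigenvalues on either side. *)
Definition spectrum (R : realType) (n : nat) (A : 'M[R[i]]_n) : set R[i] :=
  [set a | eigenvalue A a].

(* [Rcomplex R] is [R[i]] seen as a vector space over [R], so that the weights
   of the convex combinations are reals in [0, 1]. *)
Definition convex_hull (R : realType) (S : set R[i]) : set R[i] :=
  smallest (@convex_set R (Rcomplex R)) S.

(* Main.v *)
Require Import Defs.
From mathcomp Require Import all_boot all_order all_algebra.
From mathcomp Require Import complex classical_sets reals.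
From mathcomp Require Import spectral interval_inference unstable convex.

Import Order.TTheory GRing.Theory Num.Theory.

(** Write [A = V L V^-1] with [L] diagonal. The condition [y = (V V^* )^-1 x]
    says exactly that [x = V w] and [y = V^-* w] for the same vector
    [w = V^-1 x]. Substituting, [y^* x] becomes the squared norm
    [\sum_i |w_i|^2] and [y^* A x] becomes [w^* L w = \sum_i |w_i|^2 L_ii]
    ([field_of_valuesP]). As [w] ranges over the unit sphere, the weights
    [|w_i|^2] range over all of the standard simplex, so the field of values is
    the set of weighted means of the [L_ii]. These are the eigenvalues of [A]
    ([spectrumP]). A weighted mean of points lies in every convex set that
    contains them ([convex_set_mean]); conversely the set of weighted means is
    itself convex ([convex_field_of_values]) and contains each [L_ii], so it is
    the convex hull. *)

Section Convexity.
Set Implicit Arguments.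
Unset Strict Implicit.
Local Open Scope ring_scope.
Local Open Scope classical_set_scope.

(** Normalizing lets induction on [s] go through, since the weights of a tail no
    longer sum to 1: the mean over [i :: s] is the convex combination of [x i]
    and of the mean over [s] in which [x i] has its share of the total weight. *)
Lemma convex_set_normalized_sum (R : realFieldType) (M : lmodType R)
    (C : set (convex_lmodType M)) (I : Type) (s : seq I)
    (p : I -> R) (x : I -> M) :
  convex_set C -> (forall i, 0 <= p i) -> (forall i, C (x i)) ->
  0 < \sum_(i <- s) p i ->
  C ((\sum_(i <- s) p i)^-1 *: \sum_(i <- s) p i *: x i).
Proof.
move=> cC p0 Cx; elim: s => [|i s IHs]; first by rewrite big_nil ltxx.
rewrite !big_cons; set W := \sum_(j <- s) p j; set X := \sum_(j <- s) _ => WT.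
have W0 : 0 <= W by apply: sumr_ge0.
have [WE|Wn0] := eqVneq W 0.
  (* The weights over [s] all vanish, and only [x i] is left. *)
  have -> : X = 0.
    move: WE; rewrite /W /X; elim: (s) => [|j t IHt]; first by rewrite !big_nil.
    rewrite !big_cons => /eqP; rewrite paddr_eq0 ?sumr_ge0// => /andP[/eqP-> /eqP].
    by move=> /IHt->; rewrite scale0r addr0.
  move: WT; rewrite WE !addr0 => pi0.
  by rewrite scalerA mulVf ?scale1r// gt_eqF.
have Wgt : 0 < W by rewrite lt_neqAle eq_sym Wn0.
pose t := p i / (p i + W).
have t01 : 0 <= t <= 1.
  by rewrite divr_ge0 ?(ltW WT)//= ler_pdivrMr// mul1r lerDl.
have := cC (x i) (W^-1 *: X) (Itv01 (proj1 (andP t01)) (proj2 (andP t01))).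
have mem_x : (x i : convex_lmodType M) \in C by rewrite inE.
have mem_X : (W^-1 *: X : convex_lmodType M) \in C by rewrite inE; exact: IHs.
move=> /(_ mem_x mem_X); rewrite inE; congr C.
rewrite /conv/= scalerDr !scalerA /t; congr (_ *: _ + _ *: _).
  by rewrite mulrC.
have -> : onem (p i / (p i + W)) = W / (p i + W).
  apply: (mulIf (lt0r_neq0 WT)); rewrite /onem mulrBl !mulfVK ?gt_eqF//.
  by rewrite mul1r addrAC subrr add0r.
by rewrite mulrAC mulfV// mul1r.
Qed.

Lemma convex_set_mean (R : realFieldType) (M : lmodType R)
    (C : set (convex_lmodType M)) (I : finType) (p : I -> R) (x : I -> M) :
  convex_set C -> (forall i, 0 <= p i) -> \sum_i p i = 1 ->
  (forall i, C (x i)) -> C (\sum_i p i *: x i).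
Proof.
move=> cC p0 p1 Cx.
have := @convex_set_normalized_sum R M C I (index_enum I) p x cC p0 Cx.
by rewrite p1 invr1 scale1r; apply; exact: ltr01.
Qed.

End Convexity.

Section Diagonalization.
Set Implicit Arguments.
Unset Strict Implicit.
Local Open Scope ring_scope.
Local Open Scope classical_set_scope.
Local Open Scope complex_scope.
Local Open Scope sesquilinear_scope.
Variables (R : realType) (n : nat) (A V L : 'M[R[i]]_n).
Hypothesis AVL : is_diagonalization A V L.

Let V_unit : V \in unitmx. Proof. by case: AVL. Qed.
Let A_E : A = V *m L *m invmx V. Proof. by case: AVL. Qed.

Let L_E (i j : 'I_n) : L i j = L i i *+ (i == j).
Proof.
case: AVL => _ /is_diag_mxP Ld _.
have [->|ij] := eqVneq i j; first by rewrite mulr1n.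
by rewrite mulr0n Ld.
Qed.

Let delta_L (i : 'I_n) : delta_mx 0 i *m L = L i i *: delta_mx 0 i :> 'rV_n.
Proof.
by rewrite -rowE; apply/rowP => j; rewrite !mxE L_E eqxx eq_sym mulr_natr.
Qed.

Let mul_rowL (u : 'rV[R[i]]_n) i : (u *m L) 0 i = u 0 i * L i i.
Proof.
rewrite mxE (bigD1 i)//= big1 ?addr0// => j ji.
by rewrite L_E (negbTE ji) mulr0n mulr0.
Qed.

Lemma spectrumP (a : R[i]) : spectrum A a <-> exists i, a = L i i.
Proof.
split => [/eigenvalueP[v vA v0]|[i ->]].
  (* [v V] is a left eigenvector of [L]; compare a coordinate where it is not 0. *)
  have uL : (v *m V) *m L = a *: (v *m V).
    by rewrite scalemxAl -vA A_E !mulmxA mulmxKV.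
  have /rV0Pn[i ui] : v *m V != 0.
    apply: contraNneq v0 => /(congr1 (mulmx^~ (invmx V))).
    by rewrite mulmxK// mul0mx => ->.
  exists i; apply: (mulfI ui); by rewrite -mul_rowL uL [RHS]mxE mulrC.
apply/eigenvalueP; exists (delta_mx 0 i *m invmx V).
  by rewrite A_E !mulmxA mulmxKV// delta_L -scalemxAl.
apply/negP => /eqP /(congr1 (mulmx^~ V)); rewrite mulmxKV// mul0mx.
by move=> /rowP/(_ i)/eqP; rewrite !mxE !eqxx oner_eq0.
Qed.

(** With [x = V w], the constraint gives [y = (V V^* )^-1 V w = V^-* w], so that
    [y^* = w^* V^-1] cancels the outer factors of [V L V^-1]. *)
Let adj_dual (w : 'cV[R[i]]_n) :
  (invmx (V *m V ^t*) *m (V *m w)) ^t* = w ^t* *m invmx V.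
Proof.
have Vt_unit : V ^t* \in unitmx by rewrite map_unitmx unitmx_tr.
have -> : invmx (V *m V ^t*) *m (V *m w) = invmx (V ^t*) *m w.
  have VV_unit : V *m V ^t* \in unitmx by rewrite unitmx_mul V_unit.
  by apply: (can_inj (mulKmx VV_unit)); rewrite mulKVmx// -mulmxA mulKVmx.
by rewrite trmx_mul map_mxM -map_invmx -trmx_inv trmxCK.
Qed.

Lemma adj_mul_self (w : 'cV[R[i]]_n) :
  (w ^t* *m w) 0 0 = \sum_i `|w i 0| ^+ 2.
Proof. by rewrite mxE; apply: eq_bigr => i _; rewrite !mxE normCK mulrC. Qed.

Lemma adj_diag_mul (w : 'cV[R[i]]_n) :
  (w ^t* *m L *m w) 0 0 = \sum_i `|w i 0| ^+ 2 * L i i.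
Proof.
rewrite mxE; apply: eq_bigr => i _.
by rewrite mul_rowL !mxE normCK mulrAC [_^* * _]mulrC.
Qed.

(** [p i] is the squared modulus of the coordinate [w_i] of [w = V^-1 x]; every
    point of the simplex is reached by taking [w_i] to be the real square root
    of [p i]. *)
Lemma field_of_valuesP (z : R[i]) :
  two_sided_field_of_values V A z <->
  exists p : 'I_n -> R, [/\ forall i, 0 <= p i, \sum_i p i = 1 &
    z = \sum_i p i *: (L i i : Rcomplex R)].
Proof.
have scaleCE (p : R) (a : R[i]) : p *: (a : Rcomplex R) = p%:C * a.
  by case: a => a b; simpc.
split => [[x [_ [-> + ->]]]|[p [p0 p1 ->]]].
  have [w ->] : exists w, x = V *m w by exists (invmx V *m x); rewrite mulKVmx.
  rewrite adj_dual A_E !mulmxA !mulmxKV//.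
  rewrite adj_mul_self adj_diag_mul => w1.
  exists (fun i => complex.Re (w i 0) ^+ 2 + complex.Im (w i 0) ^+ 2); split.
  - by move=> i; rewrite addr_ge0 ?sqr_ge0.
  - apply: (@complexI R); rewrite rmorph_sum rmorph1 -w1.
    by apply: eq_bigr => i _; exact: add_Re2_Im2.
  - by apply: eq_bigr => i _; rewrite scaleCE add_Re2_Im2.
pose w : 'cV[R[i]]_n := \col_i (Num.sqrt (p i))%:C.
have wE i : `|w i 0| ^+ 2 = (p i)%:C.
  by rewrite mxE -add_Re2_Im2/= expr0n addr0 sqr_sqrtr.
exists (V *m w), (invmx (V *m V ^t*) *m (V *m w)); rewrite adj_dual A_E.
split=> //; rewrite !mulmxA !mulmxKV//.
  by rewrite adj_mul_self (eq_bigr _ (fun i _ => wE i)) -rmorph_sum p1.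
by rewrite adj_diag_mul; apply: eq_bigr => i _; rewrite wE scaleCE.
Qed.

(** Phrased with weights, convexity is immediate: mixing two weighted means mixes
    their weights. *)
Lemma convex_field_of_values :
  convex_set (two_sided_field_of_values V A : set (convex_lmodType (Rcomplex R))).
Proof.
move=> x y t; rewrite !inE => /field_of_valuesP[p [p0 p1 ->]].
move=> /field_of_valuesP[q [q0 q1 ->]]; apply/field_of_valuesP.
exists (fun i => t%:num * p i + (1 - t%:num) * q i); split.
- by move=> i; rewrite addr_ge0// mulr_ge0// subr_ge0.
- by rewrite big_split/= -!mulr_sumr p1 q1 !mulr1 addrC subrK.
- rewrite /conv/= !scaler_sumr -big_split/=; apply: eq_bigr => i _.
  by rewrite !scalerA scalerDl.
Qed.

Lemma spectrum_sub_field_of_values :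
  spectrum A `<=` two_sided_field_of_values V A.
Proof.
move=> _ /spectrumP[i ->]; apply/field_of_valuesP.
exists (fun j => (j == i)%:R); split => [j||].
- exact: ler0n.
- by rewrite (bigD1 i)//= eqxx big1 ?addr0// => j /negbTE->.
- rewrite (bigD1 i)//= eqxx scale1r big1 ?addr0// => j /negbTE->.
  by rewrite scale0r.
Qed.

Lemma field_of_values_sub_convex_hull :
  two_sided_field_of_values V A `<=` convex_hull (spectrum A).
Proof.
move=> _ /field_of_valuesP[p [p0 p1 ->]] C [cC specC].
apply: (convex_set_mean cC p0 p1) => i.
by apply: specC; apply/spectrumP; exists i.
Qed.

End Diagonalization.

Theorem mainTheorem1 (R : realType) (n : nat) (A V L : 'M[R[i]]_n)
    (hV : is_diagonalization A V L) :
  two_sided_field_of_values V A = convex_hull (spectrum A).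
Proof.
apply/seteqP; split; first exact: field_of_values_sub_convex_hull hV.
apply: smallest_sub; first exact: convex_field_of_values hV.
exact: spectrum_sub_field_of_values hV.
Qed.
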